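(* Let $n\ge 1$, let $W\in\mathbb{R}^{n\times n}$ be symmetric positive definite, let $\nu$ be the density of the Gaussian prior $\mathcal{N}(0,W)$ on $\mathbb{R}^n$, and let $\beta\in(0,1]$. Let $\zeta\mapsto\mathcal{L}(y_{obs}|\zeta)$ (likelihood of the true model) and $\zeta\mapsto\widehat{\mathcal{L}}(y_{obs}|\zeta)$ (likelihood of the surrogate model), for fixed data $y_{obs}$, be strictly positive measurable functions on $\mathbb{R}^n$ that are integrable with respect to $\nu$. Let $\pi$ be the posterior probability density on $\mathbb{R}^n$ with $\pi(\zeta)\propto\mathcal{L}(y_{obs}|\zeta)\,\nu(\zeta)$. Then the Markov chain on $\mathbb{R}^n$ whose one-step transition is given by the two-stage filtered Metropolis-Hastings algorithm (described in the context), with preconditioned Crank-Nicolson proposal $q(\cdot|\zeta^C)=\mathcal{N}(\sqrt{1-\beta^2}\,\zeta^C,\ \beta^2 W)$, is in detailed balance with $\pi$.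
   Context: Filtered Metropolis-Hastings algorithm (one transition from the current state $\zeta^C$ to the next state $\zeta^\star$): 1. Draw a proposal $\zeta^P\sim q(\cdot|\zeta^C)$. 2. (First stage, surrogate model.) Compute $$\widehat{\alpha}=\min\Big\{1,\frac{\widehat{\mathcal{L}}(y_{obs}|\zeta^P)}{\widehat{\mathcal{L}}(y_{obs}|\zeta^C)}\Big\}$$ and draw $u\sim\mathcal{U}(0,1)$. If $\widehat{\alpha}<u$, reject: set $\zeta^\star=\zeta^C$ and stop. If $\widehat{\alpha}\ge u$, go to step 3. 3. (Second stage, filter with the true model.) Compute $$\alpha=\min\Big\{1,\frac{\mathcal{L}(y_{obs}|\zeta^P)}{\mathcal{L}(y_{obs}|\zeta^C)}\cdot\frac{\widehat{\mathcal{L}}(y_{obs}|\zeta^C)}{\widehat{\mathcal{L}}(y_{obs}|\zeta^P)}\Big\}$$ and draw a new $u'\sim\mathcal{U}(0,1)$. If $\alpha\ge u'$, set $\zeta^\star=\zeta^P$; otherwise set $\zeta^\star=\zeta^C$. All random draws (the proposal noise, $u$, $u'$) are independent of each other and of the past. A Markov chain with transition kernel $K(x,dy)$ is in detailed balance with a probability density $\pi$ if $\pi(x)\,dx\,K(x,dy)=\pi(y)\,dy\,K(y,dx)$ as measures on $\mathbb{R}^n\times\mathbb{R}^n$, i.e. $\int_A\pi(x)K(x,B)\,dx=\int_B\pi(y)K(y,A)\,dy$ for all Borel sets $A,B\subseteq\mathbb{R}^n$. *)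

(* Defs.v *)
From HB Require Import structures.
From mathcomp Require Import all_boot all_order all_algebra.
From mathcomp Require Import all_classical all_reals all_analysis.
From mathcomp Require Import measurable_realfun.

Set Implicit Arguments.
Unset Strict Implicit.
Unset Printing Implicit Defensive.

Import Order.TTheory GRing.Theory Num.Theory.
Import numFieldNormedType.Exports.

Local Open Scope classical_set_scope.
Local Open Scope ring_scope.

(* R^n is the measurable type n.-tuple R; its product sigma-algebra is the
   Borel one. *)
Notation "''R[' R ]^ n" := (n.-tuple (measurableTypeR R))
  (at level 8, R at level 50, n at level 2, format "''R[' R ]^ n").

Section lebesgue_cons.
Context {R : realType} {n : nat}.
Variable mu : {sigma_finite_measure set 'R[R]^n -> \bar R}.

Definition tuple_consp (x : measurableTypeR R * 'R[R]^n) : 'R[R]^n.+1 :=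
  [the n.+1.-tuple _ of x.1 :: x.2].

Lemma measurable_tuple_consp : measurable_fun setT tuple_consp.
Proof. exact: measurable_cons. Qed.

Definition lebesgue_cons : set 'R[R]^n.+1 -> \bar R :=
  pushforward (lebesgue_measure \x mu)%E tuple_consp.

Let lebesgue_cons0 : lebesgue_cons set0 = 0%E.
Proof. by rewrite /lebesgue_cons /pushforward preimage_set0 measure0. Qed.

Let lebesgue_cons_ge0 A : (0 <= lebesgue_cons A)%E.
Proof. by rewrite /lebesgue_cons /pushforward measure_ge0. Qed.

Let lebesgue_cons_sigma_additive : semi_sigma_additive lebesgue_cons.
Proof.
move=> F mF tF mUF; rewrite /lebesgue_cons /pushforward preimage_bigcup.
apply: measure_semi_sigma_additive.
- by move=> k; rewrite -[X in measurable X]setTI; exact: measurable_tuple_consp.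
- apply/trivIsetP => /= i j _ _ ij; rewrite -preimage_setI.
  by move/trivIsetP : tF => /(_ _ _ _ _ ij) ->//; rewrite preimage_set0.
- rewrite -preimage_bigcup -[X in measurable X]setTI.
  exact: measurable_tuple_consp.
Qed.

HB.instance Definition _ := isMeasure.Build _ _ _ lebesgue_cons
  lebesgue_cons0 lebesgue_cons_ge0 lebesgue_cons_sigma_additive.

Let lebesgue_cons_sigma_finite : sigma_finite setT lebesgue_cons.
Proof.
have /sigma_finiteP[F [TF ndF Foo]] :=
  sigma_finiteT (@lebesgue_measure R).
have /sigma_finiteP[G [TG ndG Goo]] := sigma_finiteT mu.
pose g (t : 'R[R]^n.+1) : measurableTypeR R * 'R[R]^n :=
  (tnth t ord0, [tuple of behead t]).
have gK x : g (tuple_consp x) = x.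
  by case: x => a b; rewrite /g /=; congr pair; apply/val_inj.
have mg : measurable_fun setT g.
  apply/measurable_fun_pair; first exact: measurable_tnth.
  exact: measurable_behead.
exists (fun k => g @^-1` (F k `*` G k)).
  rewrite -preimage_bigcup (_ : \bigcup_k _ = setT) ?preimage_setT//.
  rewrite -subTset => -[x y] _.
  have [k _ Fkx] : (\bigcup_k F k) x by rewrite -TF.
  have [l _ Gly] : (\bigcup_k G k) y by rewrite -TG.
  exists (maxn k l) => //; split => /=.
    by move: x Fkx; exact/subsetPset/ndF/leq_maxl.
  by move: y Gly; exact/subsetPset/ndG/leq_maxr.
move=> k; have [mF Fk] := Foo k; have [mG Gk] := Goo k; split.
  by rewrite -[X in measurable X]setTI; apply: mg => //; exact: measurableX.
rewrite /lebesgue_cons /pushforward -comp_preimage.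
rewrite (_ : g \o tuple_consp = id) ?preimage_id; last exact/funext.
by rewrite product_measure1E// lte_mul_pinfty// ge0_fin_numE.
Qed.

HB.instance Definition _ := Measure_isSigmaFinite.Build _ _ _ lebesgue_cons
  lebesgue_cons_sigma_finite.

End lebesgue_cons.

Fixpoint lebesgue_tuple (R : realType) (n : nat) :
    {sigma_finite_measure set 'R[R]^n -> \bar R} :=
  match n with
  | 0 => \d_([tuple] : 'R[R]^0)
  | n'.+1 => lebesgue_cons (lebesgue_tuple R n')
  end.

(* Characterisation of Lebesgue measure on R^n by its values on boxes. *)
Lemma lebesgue_tuple_box (R : realType) (n : nat)
    (A : 'I_n -> set (measurableTypeR R)) : (forall i, measurable (A i)) ->
  lebesgue_tuple R n [set x | forall i, A i (tnth x i)] =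
  (\prod_(i < n) lebesgue_measure (A i))%E.
Proof.
elim: n A => [|n IHn] A mA.
  rewrite big_ord0 /= diracE mem_set//=.
  by case.
rewrite big_ord_recl /= /lebesgue_cons /pushforward.
have mbox : measurable [set x : 'R[R]^n | forall i, A (lift ord0 i) (tnth x i)].
  rewrite (_ : mkset _ = \bigcap_(i in [set: 'I_n])
      ((fun x : 'R[R]^n => tnth x i) @^-1` A (lift ord0 i))); last first.
    by apply/seteqP; split => x /= Ax i; [move=> _; exact: Ax|exact: Ax].
  apply: fin_bigcap_measurable => // i _; rewrite -[X in measurable X]setTI.
  by apply: measurable_tnth => //; exact: mA.
rewrite -IHn// -product_measure1E//.
congr (_ _); apply/seteqP; split => [[x y] /= Axy|[x y] /= [Ax Ay] i].
  split; first exact: (Axy ord0).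
  by move=> i; have := Axy (lift ord0 i); rewrite tnthS.
by have [j ->|->//] := unliftP ord0 i; rewrite tnthS; exact: Ay.
Qed.

Section gaussian.
Context {R : realType} {n : nat}.
Implicit Types (m : 'cV[R]_n) (S : 'M[R]_n) (x : 'R[R]^n).

Definition colv x : 'cV[R]_n := \col_i (tnth x i : R).

Definition gaussian_pdf m S x : R :=
  expR (- (((colv x - m)^T *m invmx S *m (colv x - m)) 0 0) / 2)
  / Num.sqrt ((2 * pi) ^+ n * \det S).

Lemma gaussian_pdf_ge0 m S x : 0 <= gaussian_pdf m S x.
Proof. by rewrite /gaussian_pdf divr_ge0 ?expR_ge0 ?sqrtr_ge0. Qed.

Lemma measurable_gaussian_pdf m S : measurable_fun setT (gaussian_pdf m S).
Proof.
have mcoord i : measurable_fun setT (fun x : 'R[R]^n => (colv x - m) i 0 : R).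
  under eq_fun do rewrite !mxE.
  by apply: measurable_funD => //; exact: measurable_tnth.
apply: measurable_funM => //; apply: measurableT_comp => //.
apply: measurable_funM => //; apply: measurableT_comp => //.
under eq_fun do rewrite mxE.
apply: measurable_sum => j; apply: measurable_funM => //.
under eq_fun do rewrite mxE.
apply: measurable_sum => k; apply: measurable_funM => //.
by under eq_fun do rewrite mxE; exact: mcoord.
Qed.

Definition gaussian m S : set 'R[R]^n -> \bar R :=
  fun A => (\int[lebesgue_tuple R n]_(x in A) (gaussian_pdf m S x)%:E)%E.

Variables (m : 'cV[R]_n) (S : 'M[R]_n).

Let gaussian0 : gaussian m S set0 = 0%E.
Proof. by rewrite /gaussian integral_set0. Qed.

Let gaussian_ge0 A : (0 <= gaussian m S A)%E.
Proof. by apply: integral_ge0 => x _; rewrite lee_fin gaussian_pdf_ge0. Qed.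

Let gaussian_sigma_additive : semi_sigma_additive (gaussian m S).
Proof.
move=> /= F mF tF mUF; rewrite /gaussian; apply: cvg_toP.
  apply: ereal_nondecreasing_is_cvgn => i j ij.
  apply: lee_sum_nneg_natr => // k _ _.
  by apply: integral_ge0 => /= x Fkx; rewrite lee_fin gaussian_pdf_ge0.
rewrite ge0_integral_bigcup//=.
- apply: measurable_funTS; apply: measurableT_comp => //.
  exact: measurable_gaussian_pdf.
- by move=> x _; rewrite lee_fin gaussian_pdf_ge0.
Qed.

HB.instance Definition _ := isMeasure.Build _ _ _ (gaussian m S)
  gaussian0 gaussian_ge0 gaussian_sigma_additive.

End gaussian.

Definition sym_posdef (R : realType) (n : nat) (W : 'M[R]_n) : Prop :=
  W^T = W /\ forall v : 'cV[R]_n, v != 0 -> 0 < (v^T *m W *m v) 0 0.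

Definition probability_density (R : realType) (n : nat) (p : 'R[R]^n -> R) :
    Prop :=
  [/\ measurable_fun setT p, forall x, 0 <= p x
    & (\int[lebesgue_tuple R n]_x (p x)%:E = 1)%E].

(* p is the probability density proportional to L * nu; the constant c is
   forced to be the inverse of the integral of L * nu. *)
Definition posterior_density (R : realType) (n : nat)
    (L nu p : 'R[R]^n -> R) : Prop :=
  probability_density p /\ exists c : R, forall z, p z = c * (L z * nu z).

Definition detailed_balance (R : realType) (n : nat) (p : 'R[R]^n -> R)
    (K : 'R[R]^n -> set 'R[R]^n -> \bar R) : Prop :=
  forall A B : set 'R[R]^n, measurable A -> measurable B ->
  (\int[lebesgue_tuple R n]_(x in A) ((p x)%:E * K x B) =
   \int[lebesgue_tuple R n]_(y in B) ((p y)%:E * K y A))%E.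

Definition pcn_proposal (R : realType) (n : nat) (W : 'M[R]_n) (beta : R)
    (zC : 'R[R]^n) : {measure set 'R[R]^n -> \bar R} :=
  gaussian (Num.sqrt (1 - beta ^+ 2) *: colv zC) (beta ^+ 2 *: W).

Definition unif01 (R : realType) : probability (measurableTypeR R) R :=
  uniform_prob (@ltr01 R).

Definition unif01x2 (R : realType) :
    probability (measurableTypeR R * measurableTypeR R)%type R :=
  (unif01 R \x unif01 R)%E.

Section filtered_mh.
Context {R : realType} {n : nat}.
Variables (q : 'R[R]^n -> {measure set 'R[R]^n -> \bar R}).
Variables (L Lhat : 'R[R]^n -> R).

Definition alphahat (zC zP : 'R[R]^n) : R := Num.min 1 (Lhat zP / Lhat zC).

Definition alpha (zC zP : 'R[R]^n) : R :=
  Num.min 1 (L zP / L zC * (Lhat zC / Lhat zP)).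

Definition filtered_mh_step (zC zP : 'R[R]^n) (u u' : R) : 'R[R]^n :=
  if alphahat zC zP < u then zC
  else if u' <= alpha zC zP then zP else zC.

(* The law of the next state.  The three draws are independent, hence jointly
   distributed as a product measure; drawing u' also when the first stage
   rejects does not affect this law, the step then ignoring u'. *)
Definition filtered_mh_kernel (zC : 'R[R]^n) : set 'R[R]^n -> \bar R :=
  pushforward (q zC \x unif01x2 R)%E
    (fun w => filtered_mh_step zC w.1 w.2.1 w.2.2).

End filtered_mh.

(* Main.v *)
(* Conditionally on the current state x and the proposal z, the move is made
   with probability a(x, z) = alphahat(x, z) alpha(x, z).  Hence both sides of
   the balance equation split into a flow term, with density
   p(x) g(x, z) a(x, z) on A x B where g(x, .) is the proposal density, and a
   rejection term supported on the diagonal, which is trivially symmetric in A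
   and B.  By Tonelli the flow term is symmetric as soon as its density is, and
   this holds because nu(x) g(x, z) and L(x) a(x, z) are both symmetric. *)
Require Import Defs.
From mathcomp Require Import all_boot all_order all_algebra.
From mathcomp Require Import all_classical all_reals all_analysis.
From mathcomp Require Import measurable_realfun ring.
Import Order.TTheory GRing.Theory Num.Theory.
Import numFieldNormedType.Exports.
Local Open Scope classical_set_scope.
Local Open Scope ring_scope.

(** * Integration against a measure given by a density *)

Section density.
Context d (T : measurableType d) (R : realType).
Variables (mu nu : {measure set T -> \bar R}) (f : T -> R).
Hypotheses (mf : measurable_fun setT f) (f0 : forall x, 0 <= f x).
Hypothesis nuE : forall A, measurable A ->
  (nu A = \int[mu]_(x in A) (f x)%:E)%E.

Import HBNNSimple.

(** By linearity over the finitely many values of [h], it suffices to treat indicators of level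
    sets, where the claim is [nuE]. *)
Lemma integral_density_nnsfun (h : {nnsfun T >-> R}) :
  (\int[nu]_x (h x)%:E = \int[mu]_x ((f x)%:E * (h x)%:E))%E.
Proof.
have mef : measurable_fun setT (EFin \o f) by exact/measurable_EFinP.
under [LHS]eq_integral do rewrite fimfunE -fsumEFin//.
rewrite [LHS]ge0_integral_fsum//; last 2 first.
- by move=> r; exact/measurable_EFinP/measurableT_comp.
- by move=> r x _; rewrite EFinM nnfun_muleindic_ge0.
under [RHS]eq_integral.
  move=> x xD; rewrite fimfunE -fsumEFin// ge0_mule_fsumr; last first.
    by move=> r; rewrite EFinM nnfun_muleindic_ge0.
  over.
rewrite [RHS]ge0_integral_fsum//; last 2 first.
- move=> r; apply: emeasurable_funM => //.
  exact/measurable_EFinP/measurableT_comp.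
- move=> r x _; rewrite mule_ge0// ?lee_fin// ?f0//.
  by have := nnfun_muleindic_ge0 h r x; rewrite -EFinM lee_fin.
apply: eq_fsbigr => r _.
rewrite integralZl_indic_nnsfun//= integral_indic//= setIT nuE//.
(* Membership of [r] in the range of [h] has been dropped, so negative [r] must be handled: their
   level sets are empty. *)
have [r0|r0] := ltP r 0.
  rewrite preimage_nnfun0// integral_set0 mule0.
  by rewrite integral0_eq// => x _; rewrite indic0 mulr0 mule0.
rewrite -ge0_integralZl//=.
- rewrite integral_mkcond; apply: eq_integral => x _.
  rewrite patchE indicE; case: ifPn => _; first by rewrite mulr1 muleC.
  by rewrite mulr0 mule0.
- exact: measurable_funTS.
- by move=> x _; rewrite lee_fin.
Qed.

(** Simple functions increase to [g], and monotone convergence applies under both [nu] and [mu]. *)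
Lemma ge0_integral_density (g : T -> \bar R) :
  measurable_fun setT g -> (forall x, 0 <= g x)%E ->
  (\int[nu]_x g x = \int[mu]_x ((f x)%:E * g x))%E.
Proof.
move=> mg g0; pose h := nnsfun_approx measurableT mg.
have mef : measurable_fun setT (EFin \o f) by exact/measurable_EFinP.
transitivity (lim (\int[nu]_x (h k x)%:E @[k --> \oo])%E).
  rewrite -monotone_convergence//=.
  - apply: eq_integral => x _; apply/esym/cvg_lim => //=.
    exact: cvg_nnsfun_approx.
  - by move=> k; exact/measurable_EFinP/measurable_funTS.
  - by move=> k x _; rewrite lee_fin.
  - by move=> x _ a b ab; rewrite lee_fin; exact/lefP/nd_nnsfun_approx.
under eq_fun do rewrite integral_density_nnsfun.
rewrite -monotone_convergence//=.
- apply: eq_integral => x _; apply/cvg_lim => //=.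
  by apply: cvgeZl => //; exact: cvg_nnsfun_approx.
- move=> k; apply: emeasurable_funM => //.
  exact/measurable_EFinP/measurable_funTS.
- by move=> k x _; rewrite mule_ge0 ?lee_fin.
- move=> x _ a b ab; rewrite lee_wpmul2l ?lee_fin//.
  exact/lefP/nd_nnsfun_approx.
Qed.

End density.

(** * Reversibility of the proposal with respect to the Gaussian prior *)

Section gaussian_reversible.
Context {R : realType} {n : nat}.
Implicit Types (W : 'M[R]_n) (x y : 'R[R]^n).

(** A singular [W] has a nonzero row vector [v] with [v *m W = 0], and its quadratic form would
    vanish at [v^T]. *)
Lemma sym_posdef_unitmx W : sym_posdef W -> W \in unitmx.
Proof.
move=> [_ W_gt0]; rewrite unitmxE unitfE; apply/negP => /det0P[v v0 vW].
have := W_gt0 v^T; rewrite trmxK vW mul0mx mxE ltxx => /(_ _)/negP.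
by apply => //; rewrite trmx_eq0.
Qed.

(** Tonelli requires measurability jointly in the current state and the proposal. *)
Lemma measurable_gaussian_pdf_scale (s : R) W :
  measurable_fun setT
    (fun w : 'R[R]^n * 'R[R]^n => gaussian_pdf (s *: colv w.1) W w.2).
Proof.
have mcoord i : measurable_fun setT
    (fun w : 'R[R]^n * 'R[R]^n => (colv w.2 - s *: colv w.1) i 0 : R).
  under eq_fun do rewrite !mxE.
  apply: measurable_funB; last apply: measurable_funM => //.
    by apply: (measurableT_comp (measurable_tnth i)).
  by apply: (measurableT_comp (measurable_tnth i)).
apply: measurable_funM => //; apply: measurableT_comp => //.
apply: measurable_funM => //; apply: measurableT_comp => //.
under eq_fun do rewrite mxE.
apply: measurable_sum => j; apply: measurable_funM => //.
under eq_fun do rewrite mxE.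
apply: measurable_sum => k; apply: measurable_funM => //.
by under eq_fun do rewrite mxE; exact: mcoord.
Qed.

(* With P = W^-1, both sides have exponent
   - (x^T P x + y^T P y - 2 sqrt(1 - beta^2) x^T P y) / (2 beta^2). *)
Lemma pcn_reversible W (beta : R) x y : sym_posdef W -> 0 < beta <= 1 ->
  gaussian_pdf 0 W x *
    gaussian_pdf (Num.sqrt (1 - beta ^+ 2) *: colv x) (beta ^+ 2 *: W) y =
  gaussian_pdf 0 W y *
    gaussian_pdf (Num.sqrt (1 - beta ^+ 2) *: colv y) (beta ^+ 2 *: W) x.
Proof.
move=> W_spd /andP[b0 b1]; have W_unit := sym_posdef_unitmx _ W_spd.
have b2_neq0 : beta ^+ 2 != 0 by rewrite expf_neq0// gt_eqF.
(* The normalising constants do not depend on the mean, so they agree on both sides and only the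
   exponents remain to be compared. *)
rewrite /gaussian_pdf !subr0 [LHS]mulrACA [RHS]mulrACA -!expRD.
apply: (congr1 (fun t => expR t * _)).
rewrite invmxZ; last by rewrite unitmxZ// unitfE.
set P := invmx W; set s := Num.sqrt _.
have PT : P^T = P by rewrite /P trmx_inv W_spd.1.
have s2 : s ^+ 2 = 1 - beta ^+ 2.
  by rewrite /s sqr_sqrtr// subr_ge0 expr_le1// ltW.
move: (colv x) (colv y) => {}x {}y.
have sym : (y^T *m P *m x) 0 0 = (x^T *m P *m y) 0 0.
  have -> : y^T *m P *m x = (x^T *m P *m y)^T.
    by rewrite !trmx_mul trmxK PT mulmxA.
  by rewrite mxE.
have quad u v : ((v - s *: u)^T *m (beta ^- 2 *: P) *m (v - s *: u)) 0 0 =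
    beta ^- 2 * ((v^T *m P *m v) 0 0 + s ^+ 2 * (u^T *m P *m u) 0 0
      - s * (v^T *m P *m u) 0 0 - s * (u^T *m P *m v) 0 0).
  rewrite -scalemxAr -scalemxAl mxE; congr (_ * _).
  have -> : (v - s *: u)^T = v^T - s *: u^T by rewrite linearB linearZ.
  rewrite !mulmxBl !mulmxBr -!scalemxAl -!scalemxAr !mxE.
  ring.
(* The coefficients match because [1 + s ^+ 2 / beta ^+ 2 = beta ^- 2]. *)
rewrite !quad sym s2; field.
by rewrite gt_eqF.
Qed.

End gaussian_reversible.

(** * Acceptance probability and law of one filtered step *)

Section filtered_mh_balance.
Context {R : realType} {n : nat}.
Variables L Lhat : 'R[R]^n -> R.
Hypotheses (L_gt0 : forall z, 0 < L z) (Lhat_gt0 : forall z, 0 < Lhat z).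
Hypotheses (L_meas : measurable_fun setT L).
Hypotheses (Lhat_meas : measurable_fun setT Lhat).
Implicit Types x z : 'R[R]^n.

Definition acceptance x z : R := alphahat Lhat x z * alpha L Lhat x z.

Lemma alphahat_bounds x z : 0 <= alphahat Lhat x z <= 1.
Proof.
by rewrite /alphahat ge_min lexx/= le_min ler01 divr_ge0// ltW.
Qed.

Lemma alpha_bounds x z : 0 <= alpha L Lhat x z <= 1.
Proof.
by rewrite /alpha ge_min lexx/= le_min ler01 mulr_ge0// divr_ge0// ltW.
Qed.

Lemma acceptance_ge0 x z : 0 <= acceptance x z.
Proof.
have /andP[h0 _] := alphahat_bounds x z; have /andP[a0 _] := alpha_bounds x z.
exact: mulr_ge0.
Qed.

Lemma acceptance_le1 x z : acceptance x z <= 1.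
Proof.
have /andP[h0 h1] := alphahat_bounds x z.
by have /andP[a0 a1] := alpha_bounds x z; exact: mulr_ile1.
Qed.

(* L x * acceptance x z =
   min (Lhat x, Lhat z) * min (L x / Lhat x, L z / Lhat z). *)
Lemma acceptance_reversible x z :
  L x * acceptance x z = L z * acceptance z x.
Proof.
have aux a b : L a * acceptance a b =
    Num.min (Lhat a) (Lhat b) * Num.min (L a / Lhat a) (L b / Lhat b).
  have La0 : L a != 0 by rewrite gt_eqF.
  have Ha0 : Lhat a != 0 by rewrite gt_eqF.
  have Hb0 : Lhat b != 0 by rewrite gt_eqF.
  have <- : Lhat a * alphahat Lhat a b = Num.min (Lhat a) (Lhat b).
    by rewrite minr_pMr ?ltW// mulr1 mulrC divfK.
  have <- : L a / Lhat a * alpha L Lhat a b =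
      Num.min (L a / Lhat a) (L b / Lhat b).
    rewrite minr_pMr ?divr_ge0 ?ltW// mulr1; congr Num.min; field.
    by rewrite La0 Ha0 Hb0.
  by rewrite mulrACA [Lhat a * _]mulrC divfK.
by rewrite !aux minC [X in _ * X]minC.
Qed.

Lemma measurable_acceptance :
  measurable_fun setT (fun w : 'R[R]^n * 'R[R]^n => acceptance w.1 w.2).
Proof.
(* On positive values the inverse is [powR] with exponent -1, whose measurability is known. *)
have inv (f : 'R[R]^n -> R) : (forall z, 0 < f z) -> measurable_fun setT f ->
    measurable_fun setT (fun z => (f z)^-1).
  move=> f0 mf; under eq_fun do rewrite -powR_inv1 ?ltW//.
  exact: (measurableT_comp (measurable_powR _)).
have m1 (f : 'R[R]^n -> R) : measurable_fun setT f ->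
    measurable_fun setT (fun w : 'R[R]^n * 'R[R]^n => f w.1).
  by move=> mf; exact: measurableT_comp.
have m2 (f : 'R[R]^n -> R) : measurable_fun setT f ->
    measurable_fun setT (fun w : 'R[R]^n * 'R[R]^n => f w.2).
  by move=> mf; exact: measurableT_comp.
apply: measurable_funM; apply: measurable_minr => //.
  by apply: measurable_funM; [exact: m2|exact: (m1 _ (inv Lhat _ _))].
apply: measurable_funM.
  by apply: measurable_funM; [exact: m2|exact: (m1 _ (inv L _ _))].
by apply: measurable_funM; [exact: m1|exact: (m2 _ (inv Lhat _ _))].
Qed.

Lemma unif01_le (a : R) : 0 <= a <= 1 -> unif01 R [set u | u <= a] = a%:E.
Proof.
move=> /andP[a0 a1]; rewrite /unif01 /= /uniform_prob integral_uniform_pdf.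
have -> : [set u | u <= a] `&` `[0, 1] = `[0, a]%classic :> set R.
  apply/seteqP; split => u /=; rewrite !in_itv/=.
    by move=> [ua /andP[-> _]].
  by move=> /andP[u0 ua]; rewrite u0 (le_trans ua a1).
rewrite (eq_integral (fun=> 1%:E)); last first.
  move=> u; rewrite inE/= in_itv/= => /andP[u0 ua].
  by rewrite /uniform_pdf u0 (le_trans ua a1) subr0 invr1.
rewrite integral_cst//= lebesgue_measure_itv/= lte_fin mul1e.
(* At [a = 0] the length formula takes its degenerate branch, with value 0. *)
by case: ltgtP a0 => // [_|<-] _; rewrite ?sube0.
Qed.

(** Since [u'] is drawn in every case, acceptance is a rectangle in [(u, u')], and its product
    measure factors. *)
Definition accept_set x z : set (measurableTypeR R * measurableTypeR R) :=
  [set u : R | u <= alphahat Lhat x z] `*` [set u : R | u <= alpha L Lhat x z].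

Lemma measurable_accept_set x z : measurable (accept_set x z).
Proof.
by apply: measurableX; rewrite -set_itvNyc; exact: measurable_itv.
Qed.

Lemma unif01x2_accept x z :
  unif01x2 R (accept_set x z) = (acceptance x z)%:E.
Proof.
have mle (a : R) : measurable [set u : measurableTypeR R | u <= a].
  by rewrite -set_itvNyc; exact: measurable_itv.
transitivity (unif01 R [set u : R | (u <= alphahat Lhat x z)%R] *
              unif01 R [set u : R | (u <= alpha L Lhat x z)%R])%E.
  exact: (product_measure1E (unif01 R) (unif01 R)).
by rewrite !unif01_le ?alphahat_bounds ?alpha_bounds.
Qed.

Lemma filtered_mh_stepE x z u u' :
  filtered_mh_step L Lhat x z u u' =
  if (u, u') \in accept_set x z then z else x.
Proof.
rewrite /filtered_mh_step ltNge.
have -> : ((u, u') \in accept_set x z) =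
    (u <= alphahat Lhat x z) && (u' <= alpha L Lhat x z).
  by apply/idP/andP; rewrite inE /accept_set.
by case: (u <= _).
Qed.

(** The next state is [z] on [accept_set x z] and [x] off it. Hence the event is everything,
    [accept_set x z], its complement or empty, according to which of [z] and [x] lie in [B]. *)
Lemma unif01x2_step x z (B : set 'R[R]^n) :
  unif01x2 R [set u | B (filtered_mh_step L Lhat x z u.1 u.2)] =
  (acceptance x z * \1_B z + (1 - acceptance x z) * \1_B x)%:E.
Proof.
pose S := [set u | B (filtered_mh_step L Lhat x z u.1 u.2)].
have SA u : accept_set x z u -> S u = B z.
  by case: u => u u' uA; rewrite /S/= filtered_mh_stepE mem_set.
have SC u : ~ accept_set x z u -> S u = B x.
  by case: u => u u' uA; rewrite /S/= filtered_mh_stepE memNset.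
have SE (D : set _) : (forall u, accept_set x z u -> D u <-> B z) ->
    (forall u, ~ accept_set x z u -> D u <-> B x) -> S = D.
  move=> DA DC; apply/funext => u; apply/propext.
  have [uA|uA] := pselect (accept_set x z u); first by rewrite SA// DA.
  by rewrite SC// DC.
rewrite -/S !indicE.
have [Bz|Bz] := pselect (B z); have [Bx|Bx] := pselect (B x).
- rewrite (SE setT)// !mem_set// !mulr1 addrC subrK.
  exact: probability_setT.
- rewrite (SE (accept_set x z))// mem_set// memNset// mulr1 mulr0 addr0.
  exact: unif01x2_accept.
- rewrite (SE (~` accept_set x z))// memNset// mem_set// mulr0 mulr1 add0r.
  rewrite probability_setC; last exact: measurable_accept_set.
  by rewrite unif01x2_accept.
- by rewrite (SE set0)// !memNset// !mulr0 addr0 measure0.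
Qed.

(** * Detailed balance for a proposal with a density *)

Section density_proposal.
Variable q : 'R[R]^n -> {measure set 'R[R]^n -> \bar R}.
Variable g : 'R[R]^n -> 'R[R]^n -> R.
Hypotheses (g_ge0 : forall x z, 0 <= g x z).
Hypothesis g_meas : measurable_fun setT (fun w => g w.1 w.2).
Hypothesis qE : forall x A, measurable A ->
  (q x A = \int[lebesgue_tuple R n]_(z in A) (g x z)%:E)%E.

(** For fixed [z] the uniform draws are integrated out first; the law of [z] is then replaced by its
    density [g x]. *)
Lemma filtered_mh_kernelE x (B : set 'R[R]^n) : measurable B ->
  filtered_mh_kernel q L Lhat x B = (\int[lebesgue_tuple R n]_z
    (g x z * (acceptance x z * \1_B z + (1 - acceptance x z) * \1_B x))%:E)%E.
Proof.
move=> mB; rewrite /filtered_mh_kernel /pushforward /product_measure1.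
have mpair : measurable_fun setT (fun z : 'R[R]^n => (x, z)).
  exact: measurable_pair1.
have macc : measurable_fun setT (acceptance x).
  exact: (measurableT_comp measurable_acceptance mpair).
transitivity (\int[q x]_z
    (acceptance x z * \1_B z + (1 - acceptance x z) * \1_B x)%:E)%E.
  apply: eq_integral => z _ /=; rewrite -unif01x2_step; congr (unif01x2 R _).
  by apply/seteqP; split => u; rewrite /xsection/= inE.
rewrite (@ge0_integral_density _ _ _ (lebesgue_tuple R n) (q x) (g x))//.
- exact: (measurableT_comp g_meas mpair).
- exact: qE.
- apply/measurable_EFinP; apply: measurable_funD; apply: measurable_funM => //.
  exact: measurable_funB.
- move=> z; rewrite lee_fin addr_ge0// mulr_ge0//.
    exact: acceptance_ge0.
  by rewrite subr_ge0 acceptance_le1.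
Qed.

Lemma detailed_balance_filtered_mh (p : 'R[R]^n -> R) :
  measurable_fun setT p -> (forall x, 0 <= p x) ->
  (forall x z, p x * g x z * acceptance x z = p z * g z x * acceptance z x) ->
  detailed_balance p (filtered_mh_kernel q L Lhat).
Proof.
move=> p_meas p_ge0 flow_sym A B mA mB.
pose mu := lebesgue_tuple R n.
pose flow (A B : set 'R[R]^n) (w : 'R[R]^n * 'R[R]^n) : \bar R :=
  (p w.1 * g w.1 w.2 * acceptance w.1 w.2 * (\1_A w.1 * \1_B w.2))%:E.
(* Both indicators are taken at [w.1]: after a rejection the start and the end are the same
   point. *)
pose stay (A B : set 'R[R]^n) (w : 'R[R]^n * 'R[R]^n) : \bar R :=
  (p w.1 * g w.1 w.2 * (1 - acceptance w.1 w.2) * (\1_A w.1 * \1_B w.1))%:E.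
have flow_ge0 C D w : (0 <= flow C D w)%E.
  by rewrite lee_fin; do ?[exact: acceptance_ge0|apply: mulr_ge0].
have stay_ge0 C D w : (0 <= stay C D w)%E.
  by rewrite lee_fin !mulr_ge0// subr_ge0 acceptance_le1.
have mind1 C : measurable C ->
    measurable_fun setT (fun w : 'R[R]^n * 'R[R]^n => \1_C w.1 : R).
  by move=> mC; apply: (measurableT_comp (measurable_indic mC)).
have mind2 C : measurable C ->
    measurable_fun setT (fun w : 'R[R]^n * 'R[R]^n => \1_C w.2 : R).
  by move=> mC; apply: (measurableT_comp (measurable_indic mC)).
have mpg : measurable_fun setT
    (fun w : 'R[R]^n * 'R[R]^n => p w.1 * g w.1 w.2).
  by apply: measurable_funM => //; exact: measurableT_comp.
have flow_meas C D : measurable C -> measurable D ->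
    measurable_fun setT (flow C D).
  move=> mC mD; apply/measurable_EFinP; apply: measurable_funM.
    by apply: measurable_funM => //; exact: measurable_acceptance.
  by apply: measurable_funM; [exact: mind1|exact: mind2].
have stay_meas C D : measurable C -> measurable D ->
    measurable_fun setT (stay C D).
  move=> mC mD; apply/measurable_EFinP; apply: measurable_funM.
    apply: measurable_funM => //; apply: measurable_funB => //.
    exact: measurable_acceptance.
  by apply: measurable_funM; exact: mind1.
have split_balance C D : measurable C -> measurable D ->
    (\int[mu]_(x in C) ((p x)%:E * filtered_mh_kernel q L Lhat x D) =
     \int[mu]_x \int[mu]_z flow C D (x, z) +
     \int[mu]_x \int[mu]_z stay C D (x, z))%E.
  move=> mC mD; rewrite -ge0_integralD//; last 4 first.
  - by move=> x _; apply: integral_ge0.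
  - apply: (@measurable_fun_fubini_tonelli_F _ _ _ _ _ mu (flow C D)) => //.
    exact: flow_meas.
  - by move=> x _; apply: integral_ge0.
  - apply: (@measurable_fun_fubini_tonelli_F _ _ _ _ _ mu (stay C D)) => //.
    exact: stay_meas.
  rewrite [LHS]integral_mkcond; apply: eq_integral => x _.
  have mpair : measurable_fun setT (fun z : 'R[R]^n => (x, z)).
    exact: measurable_pair1.
  rewrite -ge0_integralD//; last 2 first.
  - exact: (measurableT_comp (flow_meas _ _ mC mD) mpair).
  - exact: (measurableT_comp (stay_meas _ _ mC mD) mpair).
  (* Outside [C] the indicator of [C] at [x] kills both terms, which matches the restricted integral
     on the left. *)
  rewrite patchE; case: ifPn => xC; last first.
    rewrite integral0_eq// => z _.
    by rewrite /flow /stay/= !indicE (negbTE xC) !mul0r !mulr0 adde0.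
  rewrite filtered_mh_kernelE// -ge0_integralZl//=.
  - apply: eq_integral => z _; rewrite /flow /stay/= -EFinM -EFinD.
    have -> : \1_C x = 1 :> R by rewrite indicE xC.
    by congr EFin; ring.
  - apply/measurable_EFinP; apply: measurable_funM.
      exact: (measurableT_comp g_meas mpair).
    have macc : measurable_fun setT (acceptance x).
      exact: (measurableT_comp measurable_acceptance mpair).
    apply: measurable_funD; apply: measurable_funM => //.
    exact: measurable_funB.
  - move=> z _; rewrite lee_fin mulr_ge0// addr_ge0// mulr_ge0//.
      exact: acceptance_ge0.
    by rewrite subr_ge0 acceptance_le1.
  - by rewrite lee_fin.
have stayC : stay A B = stay B A.
  by apply/funext => w; rewrite /stay [\1_A _ * _]mulrC.
(* Tonelli exchanges the order of integration; after renaming, [flow_sym] identifies the integrands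
   pointwise. *)
have flowC : (\int[mu]_x \int[mu]_z flow A B (x, z) =
              \int[mu]_x \int[mu]_z flow B A (x, z))%E.
  apply: (etrans (@fubini_tonelli _ _ _ _ _ mu mu (flow A B)
    (flow_meas A B mA mB) (flow_ge0 A B))).
  apply: eq_integral => z _; apply: eq_integral => x _.
  by rewrite /flow/= flow_sym [\1_A x * _]mulrC.
apply: (etrans (split_balance A B mA mB)); rewrite stayC flowC.
exact: (esym (split_balance B A mB mA)).
Qed.

End density_proposal.

End filtered_mh_balance.

(** * The preconditioned Crank-Nicolson proposal *)

Theorem proposition1 (R : realType) (n : nat) (n_ge1 : (1 <= n)%N)
    (W : 'M[R]_n) (W_spd : sym_posdef W)
    (beta : R) (beta_bounds : 0 < beta <= 1)
    (L Lhat : 'R[R]^n -> R)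
    (L_gt0 : forall z, 0 < L z) (Lhat_gt0 : forall z, 0 < Lhat z)
    (L_meas : measurable_fun setT L) (Lhat_meas : measurable_fun setT Lhat)
    (L_int : (gaussian 0 W).-integrable setT (EFin \o L))
    (Lhat_int : (gaussian 0 W).-integrable setT (EFin \o Lhat))
    (p : 'R[R]^n -> R)
    (p_posterior : posterior_density L (gaussian_pdf 0 W) p) :
  detailed_balance p (filtered_mh_kernel (pcn_proposal W beta) L Lhat).
Proof.
have [[p_meas p_ge0 _] [c pE]] := p_posterior.
(* That the proposal has this density holds by definition of [gaussian]. *)
apply: (@detailed_balance_filtered_mh _ _ L Lhat _ _ _ _ _
  (fun x z => gaussian_pdf (Num.sqrt (1 - beta ^+ 2) *: colv x)
    (beta ^+ 2 *: W) z)) => //.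
- by move=> x z; exact: gaussian_pdf_ge0.
- exact: measurable_gaussian_pdf_scale.
- move=> x z; rewrite !pE.
  have := pcn_reversible _ _ x z W_spd beta_bounds.
  have := @acceptance_reversible _ _ L Lhat L_gt0 Lhat_gt0 x z.
  set G := gaussian_pdf 0 W; set gxz := gaussian_pdf _ _ z.
  set gzx := gaussian_pdf _ _ x => LE gE.
  (* This grouping isolates the two factors that are each symmetric in [x] and [z]. *)
  transitivity (c * (L x * acceptance L Lhat x z) * (G x * gxz)); first ring.
  by rewrite LE gE; ring.
Qed.
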